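(* Let $f(x)\in\mathbb{Z}[x]$ be a polynomial of degree $n$ having at least one root not in $\mathbb{R}$. Then $$\min\{\deg(g)\mid g\in\mathbb{Z}[x]\text{ is monic and }fg\in\Phi_0\}\ \geq\ \max\{\lfloor\pi/|\mathrm{Arg}(z)|\rfloor-n+2\mid f(z)=0,\ z\notin\mathbb{R}\}.$$
   Context: $\mathrm{Arg}(z)\in(-\pi,\pi]$ is the principal argument. For $h\in\mathbb{Z}[x]$, $\mathrm{lt}(h)$ is the leading term and $h^+,h^-\in\mathbb{N}[x]$ are the positive and negative parts, $h=h^+-h^-$ with no monomial occurring in both. $\Phi_0=\{h\in\mathbb{Z}[x]\mid \mathrm{lt}(h)=h^+\}$. The minimum of the empty set is understood as $+\infty$ (so the assertion is that every monic $g\in\mathbb{Z}[x]$ with $fg\in\Phi_0$ satisfies the degree bound). *)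

(* Defs.v *)
From HB Require Import structures.
From mathcomp Require Import all_boot all_order all_algebra.
From mathcomp Require Import all_classical all_reals all_analysis.
From mathcomp.real_closed Require Import complex.
From mathcomp Require Import lra.

Set Implicit Arguments.
Unset Strict Implicit.
Unset Printing Implicit Defensive.

Import Order.TTheory GRing.Theory Num.Theory.

Import ComplexField.Normc.

Local Open Scope ring_scope.
Local Open Scope complex_scope.

Definition lead_term (h : {poly int}) : {poly int} :=
  lead_coef h *: 'X^((size h).-1).

Definition pos_part (h : {poly int}) : {poly int} :=
  \poly_(i < size h) Num.max h`_i 0.

Definition neg_part (h : {poly int}) : {poly int} :=
  \poly_(i < size h) Num.max (- h`_i) 0.

Lemma coef_pos_part h i : (pos_part h)`_i = Num.max h`_i 0.
Proof.
by rewrite coef_poly; case: ltnP => // hi; rewrite nth_default // maxxx.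
Qed.

Lemma coef_neg_part h i : (neg_part h)`_i = Num.max (- h`_i) 0.
Proof.
by rewrite coef_poly; case: ltnP => // hi; rewrite nth_default // oppr0 maxxx.
Qed.

Lemma pos_neg_partP (h p q : {poly int}) :
  (p = pos_part h /\ q = neg_part h) <->
  [/\ h = p - q,
      forall i, 0 <= p`_i,
      forall i, 0 <= q`_i &
      forall i, p`_i = 0 \/ q`_i = 0].
Proof.
split=> [[-> ->]|[-> p0 q0 pq]].
  split=> [|i|i|i].
  - apply/polyP => i; rewrite coefB coef_pos_part coef_neg_part.
    by case: (leP h`_i 0); case: (leP (- h`_i) 0); lra.
  - by rewrite coef_pos_part le_max lexx orbT.
  - by rewrite coef_neg_part le_max lexx orbT.
  - rewrite coef_pos_part coef_neg_part.
    by case: (leP h`_i 0) => hi; [left | right; apply: max_r; lra].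
split; apply/polyP => i; rewrite (coef_pos_part, coef_neg_part) coefB;
  move: (p0 i) (q0 i); case: (pq i) => -> h1 h2;
  by rewrite ?sub0r ?subr0 ?opprK ?oppr0; case: leP => //; lra.
Qed.

Definition Phi0 (h : {poly int}) : Prop := lead_term h = pos_part h.

(* Principal argument, with values in ]-pi, pi] for z != 0; see ArgP and
   Arg_uniq. The value at 0 is irrelevant. *)
Definition Arg (R : realType) (z : R[i]) : R :=
  let t := acos (complex.Re z / normc z) in
  if 0 <= complex.Im z then t else - t.

Section ArgTheory.
Variable R : realType.
Implicit Types (z : R[i]) (t r : R).

Let bound z : z != 0 -> 0 < normc z /\ -1 <= complex.Re z / normc z <= 1.
Proof.
case: z => a b z0.
have n0 : 0 < normc (a +i* b).
  rewrite lt_neqAle eq_sym sqrtr_ge0 andbT.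
  by apply: contra z0 => /eqP/eq0_normc ->.
split=> //; rewrite -ler_norml normrM normfV (gtr0_norm n0).
rewrite ler_pdivrMr // mul1r /= -sqrtr_sqr ler_wsqrtr //.
by rewrite lerDl sqr_ge0.
Qed.

Lemma ArgP z : z != 0 ->
  - pi < Arg z <= pi /\ z = (normc z)%:C * (cos (Arg z) +i* sin (Arg z)).
Proof.
move=> z0; have [n0 hb] := bound z0.
have ac0 := acos_ge0 hb; have acpi := acos_lepi hb.
have cK : cos (acos (complex.Re z / normc z)) = complex.Re z / normc z.
  by apply: acosK; rewrite in_itv.
have hs : normc z * sin (acos (complex.Re z / normc z)) = `|complex.Im z|.
  rewrite sin_acos // -[X in X * _](@ger0_norm _ (normc z)) ?ltW //.
  rewrite -sqrtr_sqr -sqrtrM ?sqr_ge0 // mulrBr mulr1 -exprMn.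
  rewrite mulrCA divff ?gt_eqF // mulr1 -sqrtr_sqr; congr Num.sqrt.
  case: (z) => a b /=; rewrite sqr_sqrtr ?addr_ge0 ?sqr_ge0 //; lra.
have p0 := pi_gt0 R.
have e : forall c s, (normc z)%:C * (c +i* s) =
    (normc z * c) +i* (normc z * s) :> R[i].
  by move=> c s; rewrite /GRing.mul/= !mul0r subr0 addr0.
rewrite /Arg e; case: (leP 0 (complex.Im z)) => hI; split.
- by apply/andP; split => //; lra.
- rewrite cK hs ger0_norm // mulrCA divff ?gt_eqF // mulr1.
  by case: (z).
- apply/andP; split; last by lra.
  rewrite ltrN2 lt_neqAle acpi andbT; apply/eqP => h.
  by move: hs; rewrite h sinpi mulr0 => /esym/eqP; rewrite normr_eq0; lra.
- rewrite cosN sinN cK mulrN hs ltr0_norm // opprK mulrCA divff ?gt_eqF //.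
  by rewrite mulr1; case: (z).
Qed.

Lemma Arg_uniq r t : 0 < r -> - pi < t <= pi ->
  Arg (r%:C * (cos t +i* sin t)) = t.
Proof.
move=> r0 /andP[t1 t2].
have -> : r%:C * (cos t +i* sin t) = (r * cos t) +i* (r * sin t) :> R[i].
  by rewrite /GRing.mul/= !mul0r subr0 addr0.
rewrite /Arg /= !exprMn -mulrDr cos2Dsin2 mulr1 sqrtr_sqr gtr0_norm //.
rewrite mulrAC divff ?gt_eqF // mul1r pmulr_rge0 //.
have [t0|t0] := leP 0 t.
  by rewrite sin_ge0_pi ?t0 // cosK // in_itv /= t0.
rewrite ifF; first by rewrite cosKN ?opprK //; apply/andP; split; apply: ltW.
apply/negbTE; rewrite -ltNge -oppr_gt0 -sinN sin_gt0_pi //.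
by apply/andP; split; lra.
Qed.

End ArgTheory.

Definition nonreal_root (R : realType) (f : {poly int}) (z : R[i]) : Prop :=
  root (map_poly intr f) z /\ z \isn't Num.real.

(* Main.v *)
(* Write h = f g, of degree m, and let z be a nonreal root of f; conjugating, we
   may assume that t = Arg z lies in ]0, pi[.  Put u = e^{-it}.  If
   (m - 1) t <= pi, then for i < m the vector z^i u^(m-1) has argument in
   [-pi, 0], while z^m u^(m-1) has argument t.  As only the leading coefficient
   of h is positive, the imaginary part of h(z) u^(m-1) is then positive, which
   is absurd; hence (m - 1) t > pi. *)
Require Import Defs.
From mathcomp Require Import all_boot all_order all_algebra.
From mathcomp Require Import all_classical all_reals all_analysis.
From mathcomp.real_closed Require Import complex.
From mathcomp Require Import zify ring.

Import Order.TTheory GRing.Theory Num.Theory.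
Import ComplexField.Normc.

Local Open Scope classical_set_scope.
Local Open Scope ring_scope.
Local Open Scope complex_scope.

Lemma Phi0_coef_le0 (h : {poly int}) (i : nat) :
  Phi0 h -> (i < (size h).-1)%N -> h`_i <= 0.
Proof.
move=> /(congr1 (fun p : {poly int} => p`_i)).
rewrite /lead_term coefZ coefXn coef_pos_part => + hi.
by rewrite (ltn_eqF hi) mulr0 => /esym/max_idPr.
Qed.

Lemma Phi0_lead_coef_gt0 (h : {poly int}) : h != 0 -> Phi0 h -> 0 < lead_coef h.
Proof.
rewrite -lead_coef_eq0 lt_neqAle eq_sym => -> /=.
move=> /(congr1 (fun p : {poly int} => p`_(size h).-1)).
rewrite /lead_term coefZ coefXn coef_pos_part eqxx mulr1 => ->.
by rewrite le_max lexx orbT.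
Qed.

Section Polar.
Variable R : realType.
Implicit Types (z : R[i]) (t r : R).

Lemma de_moivre t (k : nat) :
  (cos t +i* sin t) ^+ k = cos (t *+ k) +i* sin (t *+ k) :> R[i].
Proof.
elim: k => [|k IH]; first by rewrite expr0 mulr0n cos0 sin0.
rewrite exprS IH mulrS cosD sinD; apply/eqP; rewrite eq_complex /=.
by apply/andP; split; apply/eqP; ring.
Qed.

(* This is the imaginary part of e^{-imt} p(z) = 0, where p has degree m + 1. *)
Lemma root_polar_Im (p : {poly int}) (m : nat) r t :
    size p = m.+2 ->
    root (map_poly intr p) (r%:C * (cos t +i* sin t)) ->
  (lead_coef p)%:~R * r ^+ m.+1 * sin t =
  \sum_(i < m.+1) (p`_i)%:~R * r ^+ i * sin (t *+ (m - i)).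
Proof.
(* [v] is the conjugate of [w], hence its inverse on the unit circle; multiplying by [v ^+ m] is the
   rotation by -mt. *)
move=> sp; set w := cos t +i* sin t; set v := cos t +i* - sin t.
have wv : w * v = 1.
  apply/eqP; rewrite eq_complex /= mulrN opprK -!expr2 cos2Dsin2 eqxx /=.
  by apply/eqP; ring.
have vE k : v ^+ k = cos (t *+ k) +i* - sin (t *+ k).
  by rewrite /v -sinN -cosN de_moivre mulNrn cosN sinN.
have wvE i : (i <= m)%N -> w ^+ i * v ^+ m = v ^+ (m - i).
  by move=> im; rewrite -{1}(subnKC im) exprD mulrA -exprMn wv expr1n mul1r.
have ImE (a : int) k (u : R[i]) :
    complex.Im (a%:~R * (r%:C * w) ^+ k * u) =
    a%:~R * r ^+ k * complex.Im (w ^+ k * u).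
  rewrite exprMn !mulrA -mulrA -rmorphXn /=.
  rewrite -(rmorph_int (real_complex R)) -rmorphM /=.
  by case: (w ^+ k * u) => x y /=; ring.
move=> /rootP /(congr1 (fun y => complex.Im (y * v ^+ m))).
rewrite mul0r (horner_coef_wide (n := m.+2)); last first.
  by rewrite size_map_inj_poly ?sp //; exact: intr_inj.
rewrite big_ord_recr /= mulrDl raddfD /= coef_map ImE.
(* The top term is rotated onto the direction of [w], which yields [sin t]. The others yield -sin((m
   - i)t), and crossing the equality removes the sign. *)
rewrite [w ^+ m.+1]exprS -[w * _ * _]mulrA wvE // subnn expr0 mulr1 /=.
rewrite /lead_coef sp /=.
rewrite mulr_suml raddf_sum /= => /eqP.
rewrite addrC addr_eq0 => /eqP ->; rewrite -sumrN; apply: eq_bigr => i _.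
have im : (i <= m)%N by rewrite -ltnS.
by rewrite coef_map ImE (wvE _ im) vE /= mulrN opprK.
Qed.

(** A zero of [sin (Arg z)] would make [z] real; this rules out the arguments 0 and pi, while -pi is
    outside the range of [Arg]. *)
Lemma nonreal_Arg z : z \isn't Num.real ->
  [/\ 0 < normc z, 0 < `|Arg z| & `|Arg z| < pi].
Proof.
move=> zr; have z0 : z != 0 by apply: contraNneq zr => ->; exact: real0.
have [/andP[lo hi] zE] := ArgP z0.
have sinA : sin (Arg z) != 0.
  apply: contraNneq zr => sin0; rewrite zE sin0 /GRing.mul /=.
  by rewrite complex_real mulr0 mul0r addr0.
split.
- rewrite lt_neqAle eq_sym; apply/andP; split.
    by apply: contra z0 => /eqP/eq0_normc ->.
  by case: z {zr z0 lo hi zE sinA} => a b; exact: sqrtr_ge0.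
- by rewrite normr_gt0; apply: contraNneq sinA => ->; rewrite sin0.
- rewrite ltr_norml lo lt_neqAle hi andbT.
  by apply: contraNneq sinA => ->; rewrite sinpi.
Qed.

Lemma Phi0_Arg_lt (h : {poly int}) z :
    h != 0 -> Phi0 h -> nonreal_root h z ->
  pi < `|Arg z| *+ (size h).-2.
Proof.
move=> h0 hP [hz zr]; rewrite ltNge; apply/negP.
have [r0 t0 tpi] := nonreal_Arg _ zr.
have [_ zE] : - pi < Arg z <= pi /\
    z = (normc z)%:C * (cos (Arg z) +i* sin (Arg z)).
  by apply: ArgP; apply: contraNneq zr => ->; exact: real0.
(* A nonzero polynomial with a root is not constant, so [(size h).-2] is really deg h - 1, without
   truncation. *)
have /root_size_gt1 : map_poly intr h != 0 :> {poly R[i]}.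
  by rewrite -size_poly_eq0 size_map_inj_poly ?size_poly_eq0 //; exact: intr_inj.
move=> /(_ _ hz); rewrite size_map_inj_poly //; last exact: intr_inj.
case sh : (size h) => [|[|m]] //= _ tm.
rewrite zE in hz; have := root_polar_Im _ _ _ _ sh hz.
move: r0 t0 tpi tm; move: (normc z) (Arg z) => r t r0 t0 tpi tm.
have lc : 0 < (lead_coef h)%:~R * r ^+ m.+1.
  by rewrite mulr_gt0 ?exprn_gt0 // ltr0z Phi0_lead_coef_gt0.
(* The identity is odd in t, so t may be replaced by |t|. *)
move=> /(congr1 ( *%R (Num.sg t))); rewrite mulr_sumr mulrCA.
have sgE k : Num.sg t * sin (t *+ k) = sin (`|t| *+ k).
  rewrite normrEsg -mulrnAr; case: sgrP; rewrite ?mul0r ?sin0 ?mul1r //.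
  by rewrite !mulN1r sinN.
rewrite -[t in sin t]mulr1n sgE mulr1n => E.
have : 0 < (lead_coef h)%:~R * r ^+ m.+1 * sin `|t|.
  by rewrite mulr_gt0 // sin_gt0_pi // t0.
rewrite E ltNge => /negP; apply; apply: sumr_le0 => i _.
(* Every index [i <= m] lies below the degree, so its coefficient is at most 0; its sine is
   nonnegative because 0 <= (m - i)|t| <= m|t| <= pi. *)
rewrite mulrCA sgE; apply: mulr_le0_ge0.
  rewrite mulr_le0_ge0 ?exprn_ge0 ?(ltW r0) // lerz0 Phi0_coef_le0 // sh.
  exact: ltn_ord.
rewrite sin_ge0_pi // mulrn_wge0 //=; apply: le_trans tm.
by rewrite ler_wpMn2l // leq_subr.
Qed.

End Polar.

Theorem theorem5p5 (R : realType) (f : {poly int}) (n : nat)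
    (hn : size f = n.+1)
    (hroot : exists z : R[i], nonreal_root f z) :
  (ereal_inf [set ((size g).-1%:R : R)%:E |
                g in [set g : {poly int} | g \is monic /\ Phi0 (f * g)]]
   >=
   ereal_sup [set ((Num.floor (pi / `|Arg z|) - n%:Z + 2)%:~R : R)%:E |
                z in [set z : R[i] | nonreal_root f z]])%E.
Proof.
apply: ge_ereal_sup => _ [z [fz zr] <-].
apply: le_ereal_inf_tmp => _ [g [gm fg0] <-].
have [_ t0 _] := nonreal_Arg _ _ zr.
have f0 : f != 0 by rewrite -size_poly_eq0 hn.
have g0 := monic_neq0 gm.
have fgz : nonreal_root (f * g) z.
  by split=> //; rewrite rmorphM /= rootM fz.
have := Phi0_Arg_lt _ _ _ (mulf_neq0 f0 g0) fg0 fgz.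
(* Since deg(fg) - 1 = n + deg g - 1, this reads pi / |Arg z| < n + deg g - 1. *)
rewrite size_mul // hn -[ltRHS]mulr_natl -ltr_pdivrMr // => lt_pi.
rewrite lee_fin -[leRHS]/((size g).-1%:Z%:~R) ler_int.
have sg : (0 < size g)%N by rewrite size_poly_gt0.
(* A nonnegative floor strictly below [(size (f * g)).-2] excludes truncation there. Strictness
   between integers then gives floor + 1 <= n + deg g - 1, whence the + 2. *)
have fl0 : 0 <= Num.floor (pi / `|Arg z|).
  by rewrite floor_ge0 divr_ge0 ?pi_ge0.
have := le_lt_trans (floor_le (pi / `|Arg z|)) lt_pi.
rewrite -[ltRHS]/((_)%:Z%:~R) ltr_int.
by move: (Num.floor _) fl0 (size g) sg => k k0 s s0; lia.
Qed.
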